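(* For all integers $n\ge 1$ and $d\ge 2$ one has $f^\circ_d(n)=\max\left\{1,\frac{n}{2^d}\right\}\cdot\lambda_d(B_d)$.
   Context: $\lambda_d$ denotes Lebesgue measure on $\mathbb{R}^d$ and $B_d\subset\mathbb{R}^d$ is the open ball of diameter $1$ centered at the origin. An open set $\mathcal{P}\subset\mathbb{R}^d$ avoids integral distances if no two points of $\mathcal{P}$ have Euclidean distance equal to a positive integer. $f^\circ_d(n)$ is the supremum of $\lambda_d(\mathcal{P})$ over all open sets $\mathcal{P}\subset\mathbb{R}^d$ that avoid integral distances and have exactly $n$ connected components, each of which is a $d$-dimensional open ball (equivalently, $\mathcal{P}$ is a union of $n$ pairwise disjoint nonempty open balls, necessarily of diameter at most $1$). *)

(* Defs.v *)
From HB Require Import structures.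
From mathcomp Require Import all_boot all_order all_algebra.
From mathcomp Require Import all_classical all_reals all_analysis.

Set Implicit Arguments.
Unset Strict Implicit.
Unset Printing Implicit Defensive.

Import Order.TTheory GRing.Theory Num.Theory.
Import numFieldNormedType.Exports.

Local Open Scope classical_set_scope.
Local Open Scope ring_scope.

(* R^d is 'rV[R]_d.  The library norm on 'rV[R]_d is the sup norm: it induces
   the usual topology, used for [open] and [connected_component], but not the
   Euclidean distance. *)
Definition eucl_dist (R : realType) (d : nat) (x y : 'rV[R]_d) : R :=
  Num.sqrt (\sum_(i < d) (x ord0 i - y ord0 i) ^+ 2).

Definition eucl_ball (R : realType) (d : nat) (c : 'rV[R]_d) (r : R) :
    set 'rV[R]_d :=
  [set x | eucl_dist c x < r].

Definition is_open_eucl_ball (R : realType) (d : nat) (A : set 'rV[R]_d) : Prop :=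
  exists (c : 'rV[R]_d) (r : R), 0 < r /\ A = eucl_ball c r.

Definition box (R : realType) (d : nat) (a b : 'rV[R]_d) : set 'rV[R]_d :=
  [set x | forall i : 'I_d, a ord0 i < x ord0 i <= b ord0 i].

Definition box_volume (R : realType) (d : nat) (a b : 'rV[R]_d) : R :=
  \prod_(i < d) Num.max 0 (b ord0 i - a ord0 i).

(* Lebesgue measure on R^d, for d >= 1, as the outer measure generated by the
   volume of half-open boxes; it is total on sets, and it is the Lebesgue
   measure on its Caratheodory-measurable sets, hence on all open sets.  For
   d = 1 this is the construction behind the library's [lebesgue_measure]. *)
Definition lebesgue (R : realType) (d : nat) (A : set 'rV[R]_d) : \bar R :=
  ereal_inf [set s | exists a b : nat -> 'rV[R]_d,
    A `<=` \bigcup_k box (a k) (b k) /\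
    s = (\sum_(k <oo) (box_volume (a k) (b k))%:E)%E].

Definition avoids_integral_distances (R : realType) (d : nat)
    (P : set 'rV[R]_d) : Prop :=
  forall x y : 'rV[R]_d, P x -> P y ->
  forall k : nat, (0 < k)%N -> eucl_dist x y <> k%:R.

Definition components (R : realType) (d : nat) (P : set 'rV[R]_d) :
    set (set 'rV[R]_d) :=
  [set connected_component P x | x in P].

Definition ball_configuration (R : realType) (d n : nat) (P : set 'rV[R]_d) :
    Prop :=
  [/\ open P,
      avoids_integral_distances P,
      (components P #= `I_n)%card &
      forall C : set 'rV[R]_d, components P C -> is_open_eucl_ball C].

Definition f_circ (R : realType) (d n : nat) : \bar R :=
  ereal_sup [set lebesgue P | P in @ball_configuration R d n].

(* The open ball of diameter 1 centered at the origin. *)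
Definition unit_diam_ball (R : realType) (d : nat) : set 'rV[R]_d :=
  eucl_ball 0 (2^-1).
Arguments unit_diam_ball : clear implicits.

(* Main.v *)
(* Two points of disjoint balls of radii r and r' whose centers are at distance D
   realise every distance in the open interval (D - r - r', D + r + r'), so avoiding
   integers forces r + r' <= 1/2; likewise r <= 1/2 for a single ball.  Under these
   constraints convexity of the d-th power bounds the sum of the (2r)^d by
   max(1, n/2^d).  Conversely the points (m^2, m, 0, ...) with m = K^i have pairwise
   distances slightly below a half-integer when K is large, so balls around them whose
   radii add up pairwise to a bit less than 1/2 avoid integral distances: take all
   radii close to 1/4, or one radius close to 1/2 and the others tiny. *)
Require Import Defs.
From mathcomp Require Import all_boot all_order all_algebra.
From mathcomp Require Import all_classical all_reals all_analysis.
From mathcomp Require Import ring lra.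

Set Implicit Arguments.
Unset Strict Implicit.
Unset Printing Implicit Defensive.

Import Order.TTheory GRing.Theory Num.Theory.
Import numFieldNormedType.Exports.

Local Open Scope classical_set_scope.
Local Open Scope ring_scope.

(** * Outer Lebesgue measure: scaling, subadditivity, additivity across hyperplanes *)

Section Lebesgue.
Variables (R : realType) (d : nat).
Implicit Types (A B : set 'rV[R]_d) (a b : 'rV[R]_d).

Lemma box_volume_ge0 a b : 0 <= box_volume a b.
Proof. by apply: prodr_ge0 => i _; rewrite le_max lexx. Qed.

Lemma lebesgue_le_cover A (a b : nat -> 'rV[R]_d) :
  A `<=` \bigcup_k box (a k) (b k) ->
  (lebesgue A <= \sum_(k <oo) (box_volume (a k) (b k))%:E)%E.
Proof. by move=> Aab; apply: ereal_inf_lbound; exists a, b. Qed.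

Lemma le_lebesgue A (x : \bar R) :
  (forall a b : nat -> 'rV[R]_d, A `<=` \bigcup_k box (a k) (b k) ->
    (x <= \sum_(k <oo) (box_volume (a k) (b k))%:E)%E) ->
  (x <= lebesgue A)%E.
Proof.
by move=> h; apply: le_ereal_inf_tmp => _ [a [b [Aab ->]]]; exact: h.
Qed.

Lemma lebesgue_ge0 A : (0 <= lebesgue A)%E.
Proof.
apply: le_lebesgue => a b _; apply: nneseries_ge0 => k _ _.
by rewrite lee_fin box_volume_ge0.
Qed.

Lemma lebesgue_mono A B : A `<=` B -> (lebesgue A <= lebesgue B)%E.
Proof.
move=> AB; apply: le_lebesgue => a b Bab; apply: lebesgue_le_cover.
exact: subset_trans Bab.
Qed.

(** The map [x |-> c + t *: x] turns a box cover of [A] into one of [B] and multiplies each volume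
    by [t ^+ d]. One inequality is enough, since the inverse map yields the other. *)
Lemma lebesgue_affine A B (c : 'rV[R]_d) (t : R) : 0 < t ->
  (forall x, B x -> A (t^-1 *: (x - c))) ->
  (lebesgue B <= (t ^+ d)%:E * lebesgue A)%E.
Proof.
move=> t0 BA; have tn0 : t != 0 by rewrite gt_eqF.
have td0 : 0 < t ^+ d by rewrite exprn_gt0.
(* Dividing by [t ^+ d] leaves [lebesgue A] alone on the right, where it is bounded below cover by
   cover. *)
suff : ((t ^- d)%:E * lebesgue B <= lebesgue A)%E.
  move=> h; rewrite -[leLHS]mul1e -(divff (lt0r_neq0 td0)) EFinM -muleA.
  by rewrite lee_pmul2l ?lte_fin.
apply: le_lebesgue => a b Aab.
rewrite muleC -lee_pdivlMr; last by rewrite invr_gt0.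
rewrite invrK muleC -nneseriesZl; last first.
  by move=> k _; rewrite lee_fin box_volume_ge0.
have vol a' b' : box_volume (c + t *: a') (c + t *: b') = t ^+ d * box_volume a' b'.
  have -> : t ^+ d = \prod_(i < d) t by rewrite prodr_const card_ord.
  rewrite /box_volume -big_split /=.
  apply: eq_bigr => i _; rewrite !mxE maxr_pMr ?mulr0; last exact: ltW.
  by congr Num.max; ring.
rewrite (eq_eseriesr (g := fun k =>
  (box_volume (c + t *: a k) (c + t *: b k))%:E)); last first.
  by move=> k _; rewrite vol EFinM.
apply: lebesgue_le_cover => x /BA /Aab [k _ xk]; exists k => // i.
have := xk i; rewrite !mxE ler_pdivrMl // ltr_pdivlMl //.
by rewrite ltrBrDl lerBlDl.
Qed.

Lemma lebesgueU A B : (lebesgue (A `|` B) <= lebesgue A + lebesgue B)%E.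
Proof.
have [->|/eqP Aoo] := eqVneq (lebesgue A) +oo%E.
  by rewrite addye ?leey// gt_eqF// (lt_le_trans _ (lebesgue_ge0 B)).
have [->|/eqP Boo] := eqVneq (lebesgue B) +oo%E.
  by rewrite addey ?leey// gt_eqF// (lt_le_trans _ (lebesgue_ge0 A)).
have Afin : lebesgue A \is a fin_num.
  by rewrite ge0_fin_numE ?lebesgue_ge0// ltey; apply/eqP.
have Bfin : lebesgue B \is a fin_num.
  by rewrite ge0_fin_numE ?lebesgue_ge0// ltey; apply/eqP.
apply/lee_addgt0Pr => e e0.
have e2 : 0 < e / 2 by rewrite divr_gt0.
have [_ [a [b [Aab ->]]] hA] := lb_ereal_inf_adherent e2 Afin.
have [_ [a' [b' [Bab ->]]] hB] := lb_ereal_inf_adherent e2 Bfin.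
rewrite [e]splitr EFinD addeACA.
apply: le_trans (leeD (ltW hA) (ltW hB)).
(* Even indices enumerate the cover of [A], odd indices that of [B]. *)
pose mix (u v : nat -> 'rV[R]_d) k := if odd k then v k./2 else u k./2.
apply: (@le_trans _ _ (\sum_(k <oo) (box_volume (mix a a' k) (mix b b' k))%:E)%E).
  apply: lebesgue_le_cover => x [/Aab|/Bab] [k _ xk].
    by exists k.*2 => //; rewrite /mix odd_double doubleK.
  by exists k.*2.+1 => //; rewrite /mix /= odd_double /= uphalf_double.
have v0 (u v : nat -> 'rV[R]_d) k : (0 <= (box_volume (u k) (v k))%:E :> \bar R)%E.
  by rewrite lee_fin box_volume_ge0.
(* Partial sums suffice: the first [N] mixed terms are among the first [N.*2], which form [N]
   complete pairs. *)
apply: lime_le; first by apply: is_cvg_nneseries => k _ _; exact: v0.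
apply: nearW => N.
have -> : (\sum_(k <oo) (box_volume (a k) (b k))%:E +
           \sum_(k <oo) (box_volume (a' k) (b' k))%:E =
           \sum_(k <oo) ((box_volume (a k) (b k))%:E + (box_volume (a' k) (b' k))%:E))%E.
  by rewrite nneseriesD// => k _ _; exact: v0.
apply: (@le_trans _ _ (\sum_(0 <= k < N)
   ((box_volume (a k) (b k))%:E + (box_volume (a' k) (b' k))%:E))%E); last first.
  by apply: nneseries_lim_ge => k _ _; rewrite adde_ge0 ?v0.
have -> : (\sum_(0 <= k < N)
   ((box_volume (a k) (b k))%:E + (box_volume (a' k) (b' k))%:E) =
   \sum_(0 <= k < N.*2) (box_volume (mix a a' k) (mix b b' k))%:E)%E.
  elim: N => [|N IH]; first by rewrite !big_geq.
  rewrite doubleS !big_nat_recr//= IH -addeA; congr (_ + (_ + _))%E.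
    by rewrite /mix odd_double doubleK.
  by rewrite /mix /= odd_double /= uphalf_double.
by apply: lee_sum_nneg_natr => //; rewrite -addnn leq_addr.
Qed.

(** Degenerate boxes have volume 0 only for positive [d]; for [d = 0] the empty product gives every
    box volume 1. *)
Lemma lebesgue0 : (0 < d)%N -> lebesgue (@set0 'rV[R]_d) = 0%E.
Proof.
move=> d0; apply/eqP; rewrite eq_le lebesgue_ge0 andbT.
apply: le_trans (@lebesgue_le_cover _ (fun=> 0) (fun=> 0) _) _ => //.
rewrite eseries0// => k _ _; congr EFin; apply/eqP; rewrite prodf_seq_eq0.
by apply/hasP; exists (Ordinal d0); rewrite ?mem_index_enum//= subrr maxxx.
Qed.

Lemma lebesgue_cover_sum (A : set 'rV[R]_d) (F : nat -> set 'rV[R]_d) n :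
  (0 < d)%N -> A `<=` \bigcup_(k in `I_n) F k ->
  (lebesgue A <= \sum_(k < n) lebesgue (F k))%E.
Proof.
move=> d0; elim: n A => [|n IH] A AF.
  by rewrite big_ord0 -(lebesgue0 d0); apply: lebesgue_mono => x /AF [].
rewrite big_ord_recr /=.
apply: (@le_trans _ _ (lebesgue ((\bigcup_(k in `I_n) F k) `|` F n))).
  apply: lebesgue_mono => x /AF [k /= ]; rewrite ltnS leq_eqVlt => /orP[/eqP ->|kn] Fx.
    by right.
  by left; exists k.
apply: le_trans (lebesgueU _ _) _; rewrite leeD2r//; exact: IH.
Qed.

(** Cutting each box of a cover along the hyperplane where coordinate [i] equals [s] yields covers
    of [A] and of [B] with no more volume in total. This stands in for Caratheodory measurability of
    balls. *)
Lemma lebesgueU_separated A B (i : 'I_d) (s : R) :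
  (forall x, A x -> x ord0 i <= s) -> (forall x, B x -> s < x ord0 i) ->
  (lebesgue A + lebesgue B <= lebesgue (A `|` B))%E.
Proof.
move=> As Bs; apply: le_lebesgue => a b ab.
(* [lo] caps upper corners at [s] and [hi] raises lower corners to [s]; the weak bound on [A] and
   the strict one on [B] match half-open boxes. *)
pose lo (u : 'rV[R]_d) : 'rV[R]_d := \row_j if j == i then Num.min (u ord0 j) s else u ord0 j.
pose hi (u : 'rV[R]_d) : 'rV[R]_d := \row_j if j == i then Num.max (u ord0 j) s else u ord0 j.
have cA : A `<=` \bigcup_k box (a k) (lo (b k)).
  move=> x Ax; have [k _ xk] := ab _ (or_introl Ax); exists k => // j.
  have := xk j; rewrite mxE; case: eqP => [->|//] /andP[-> h] /=.
  by rewrite le_min h As.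
have cB : B `<=` \bigcup_k box (hi (a k)) (b k).
  move=> x Bx; have [k _ xk] := ab _ (or_intror Bx); exists k => // j.
  have := xk j; rewrite mxE; case: eqP => [->|//] /andP[h ->].
  by rewrite gt_max h Bs.
apply: le_trans (leeD (lebesgue_le_cover cA) (lebesgue_le_cover cB)) _.
rewrite -nneseriesD; try by move=> k _ _; rewrite lee_fin box_volume_ge0.
apply: lee_nneseries => k _; first by rewrite -EFinD lee_fin addr_ge0 ?box_volume_ge0.
rewrite -EFinD lee_fin /box_volume.
rewrite (bigD1 i)//= [X in _ + X](bigD1 i)//= [leRHS](bigD1 i)//=.
rewrite !mxE eqxx.
set p := \prod_(j | _) _; set q := \prod_(j | _) _; set r := \prod_(j | _) _.
have -> : p = r by apply: eq_bigr => j /negbTE ji; rewrite mxE ji.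
have -> : q = r by apply: eq_bigr => j /negbTE ji; rewrite mxE ji.
rewrite -mulrDl ler_wpM2r//; first by apply: prodr_ge0 => j _; rewrite le_max lexx.
(* What remains is the one-dimensional cut of []x, y]] at [s], empty intervals included. *)
set x := a k ord0 i; set y := b k ord0 i.
rewrite /Num.max /Num.min; do ! case: ifPn => //; rewrite -?leNgt; lra.
Qed.

(** By induction: the hyperplane at height [s n] separates the last set from all earlier ones. *)
Lemma lebesgue_sum_separated (i : 'I_d) (F : nat -> set 'rV[R]_d) (s : nat -> R) n :
  (forall k x, (k < n)%N -> F k x -> s k < x ord0 i <= s k.+1) ->
  {homo s : k l / (k <= l)%N >-> k <= l} ->
  (\sum_(k < n) lebesgue (F k) <= lebesgue (\bigcup_(k in `I_n) F k))%E.
Proof.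
move=> Fs smono; elim: n Fs => [|n IH] Fs; first by rewrite big_ord0 lebesgue_ge0.
rewrite big_ord_recr /=.
apply: (@le_trans _ _ (lebesgue (\bigcup_(k in `I_n) F k) + lebesgue (F n))%E).
  by rewrite leeD2r// IH// => k x kn; apply: Fs; rewrite ltnS ltnW.
apply: le_trans (@lebesgueU_separated _ _ i (s n) _ _) _.
- move=> x [k /= kn /(Fs k x (ltnW kn)) /andP[_ h]].
  by apply: le_trans h _; exact: smono.
- by move=> x /(Fs n x (ltnSn n)) /andP[].
apply: lebesgue_mono => x [[k /= kn Fx]|Fx]; first by exists k => //=; apply: ltnW.
by exists n => //=.
Qed.

End Lebesgue.

(** * The Euclidean norm; topology and volume of its balls *)

Section EuclideanNorm.
Variables (R : realType) (d : nat).
Implicit Types (v w x y c : 'rV[R]_d) (t r : R).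

Definition enorm v : R := Num.sqrt (\sum_(i < d) v ord0 i ^+ 2).

Lemma eucl_distE x y : eucl_dist x y = enorm (x - y).
Proof.
by rewrite /eucl_dist /enorm; congr Num.sqrt; apply: eq_bigr => i _; rewrite !mxE.
Qed.

Lemma eucl_ballE c r x : eucl_ball c r x = (enorm (c - x) < r).
Proof. by rewrite /eucl_ball /= eucl_distE. Qed.

Lemma enorm_ge0 v : 0 <= enorm v.
Proof. exact: sqrtr_ge0. Qed.

Lemma enorm_sqr v : enorm v ^+ 2 = \sum_(i < d) v ord0 i ^+ 2.
Proof. by rewrite sqr_sqrtr// sumr_ge0// => i _; rewrite sqr_ge0. Qed.

Lemma enormZ t v : enorm (t *: v) = `|t| * enorm v.
Proof.
rewrite /enorm -sqrtr_sqr -sqrtrM ?sqr_ge0// mulr_sumr.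
by congr Num.sqrt; apply: eq_bigr => i _; rewrite mxE exprMn.
Qed.

Lemma enormN v : enorm (- v) = enorm v.
Proof. by rewrite -scaleN1r enormZ normrN1 mul1r. Qed.

Lemma enorm_distC x y : enorm (x - y) = enorm (y - x).
Proof. by rewrite -enormN opprB. Qed.

Lemma enorm0 : enorm 0 = 0.
Proof. by rewrite -(scale0r 0) enormZ normr0 mul0r. Qed.

Lemma enorm_eq0 v : enorm v = 0 -> v = 0.
Proof.
move=> v0; have := enorm_sqr v; rewrite v0 expr0n => /esym h.
apply/rowP => i; rewrite mxE; apply/eqP; rewrite -sqrf_eq0; apply/eqP.
by apply: (psumr_eq0P _ h) => // j _; rewrite sqr_ge0.
Qed.

Lemma coord_le_enorm v i : `|v ord0 i| <= enorm v.
Proof.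
rewrite -sqrtr_sqr ler_sqrt ?sumr_ge0//; last by move=> j _; rewrite sqr_ge0.
by rewrite (bigD1 i)//= lerDl sumr_ge0// => j _; rewrite sqr_ge0.
Qed.

Lemma enormD v w : enorm (v + w) <= enorm v + enorm w.
Proof.
have [v0|v0] := eqVneq (enorm v) 0.
  by rewrite (enorm_eq0 v0) add0r enorm0 add0r.
have [w0|w0] := eqVneq (enorm w) 0.
  by rewrite (enorm_eq0 w0) addr0 enorm0 addr0.
set a := enorm v in v0 *; set b := enorm w in w0 *.
have a0 : 0 < a by rewrite lt0r v0 enorm_ge0.
have b0 : 0 < b by rewrite lt0r w0 enorm_ge0.
pose C := \sum_(i < d) v ord0 i * w ord0 i.
have expand s t : \sum_(i < d) (s * v ord0 i + t * w ord0 i) ^+ 2 =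
    s ^+ 2 * a ^+ 2 + t ^+ 2 * b ^+ 2 + 2 * s * t * C.
  rewrite /a /b !enorm_sqr !mulr_sumr -!big_split /=.
  by apply: eq_bigr => i _; ring.
(* Cauchy-Schwarz: expand |b v - a w|^2 >= 0 and divide by 2ab. *)
have CS : C <= a * b.
  have : 0 <= \sum_(i < d) (b * v ord0 i + - a * w ord0 i) ^+ 2.
    by apply: sumr_ge0 => i _; rewrite sqr_ge0.
  rewrite expand => h; have ab0 : 0 < a * b by rewrite mulr_gt0.
  rewrite -(ler_pM2l ab0); nra.
have -> : enorm (v + w) = Num.sqrt (\sum_(i < d) (1 * v ord0 i + 1 * w ord0 i) ^+ 2).
  by congr Num.sqrt; apply: eq_bigr => i _; rewrite !mxE !mul1r.
rewrite expand -[leRHS]ger0_norm ?addr_ge0 ?enorm_ge0// -sqrtr_sqr.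
rewrite ler_sqrt ?sqr_ge0//; nra.
Qed.

(** The topology on ['rV[R]_d] is that of the sup norm, so continuity is derived from that of the
    coordinates. *)
Lemma enorm_continuous c : continuous (fun x => enorm (c - x)).
Proof.
move=> x; apply: (@continuous_comp _ _ _
  (fun x : 'rV[R]_d => \sum_(i < d) (c - x) ord0 i ^+ 2) Num.sqrt).
  apply: (continuous_big (op := +%R) (x0 := 0)) => [|i _ z]; first exact: add_continuous.
  apply: (@continuous_comp _ _ _ (fun z : 'rV[R]_d => (c - z) ord0 i) (fun t => t ^+ 2)).
    apply: (@continuous_comp _ _ _ (fun z : 'rV[R]_d => c - z)
      (fun z : 'rV[R]_d => z ord0 i)); last exact: coord_continuous.
    by apply: continuousB; [exact: cst_continuous|exact: cvg_id].
  exact: exprn_continuous.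
exact: sqrt_continuous.
Qed.

Lemma open_eucl_ball c r : open (eucl_ball c r).
Proof.
have -> : eucl_ball c r = (fun x => enorm (c - x)) @^-1` [set t | t < r].
  by apply/seteqP; split => x /=; rewrite eucl_ballE.
by apply: open_comp => [x _|]; [exact: enorm_continuous|exact: open_lt].
Qed.

Lemma eucl_ball_center c r : 0 < r -> eucl_ball c r c.
Proof. by rewrite eucl_ballE subrr enorm0. Qed.

(** The segments from the centre fill the ball and all contain [c]. *)
Lemma connected_eucl_ball c r : 0 < r -> connected (eucl_ball c r).
Proof.
move=> r0; pose seg x := (fun t : R => c + t *: (x - c)) @` `[0, 1].
have -> : eucl_ball c r = \bigcup_(x in eucl_ball c r) seg x.
  apply/seteqP; split => [x xB|y [x xB [t /=]]].
    exists x => //; exists 1; rewrite /= ?in_itv/= ?ler01 ?lexx//.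
    by rewrite scale1r addrC subrK.
  rewrite in_itv/= => /andP[t0 t1] <-; move: xB; rewrite !eucl_ballE.
  have -> : c - (c + t *: (x - c)) = t *: (c - x).
    by rewrite opprD addNKr -scalerN opprB.
  by rewrite enormZ ger0_norm//; apply: le_lt_trans; rewrite ler_piMl ?enorm_ge0.
apply: bigcup_connected.
  exists c => x xB; exists 0; rewrite /= ?in_itv/= ?lexx ?ler01//.
  by rewrite scale0r addr0.
move=> x xB; apply: connected_continuous_connected; first exact: segment_connected.
apply: continuous_subspaceT => t; apply: cvgD; first exact: cst_continuous.
exact: scalel_continuous.
Qed.

(** The homothety of ratio [r / s] taking [c'] to [c] maps the second ball onto the first. *)
Lemma lebesgue_eucl_ball_le c c' r s : 0 < r -> 0 < s ->
  (lebesgue (eucl_ball c r) <= ((r / s) ^+ d)%:E * lebesgue (eucl_ball c' s))%E.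
Proof.
move=> r0 s0; have rs0 : 0 < r / s by rewrite divr_gt0.
apply: (@lebesgue_affine _ _ _ _ (c - (r / s) *: c')) => // x.
rewrite !eucl_ballE.
have -> : c' - (r / s)^-1 *: (x - (c - (r / s) *: c')) = (r / s)^-1 *: (c - x).
  rewrite opprB addrCA scalerDr scalerA mulVf ?gt_eqF// scale1r opprD addrA subrr.
  by rewrite add0r -scalerN opprB.
rewrite enormZ gtr0_norm ?invr_gt0// ltr_pdivrMl//.
by rewrite divfK// gt_eqF.
Qed.

Lemma lebesgue_eucl_ball c r : 0 < r ->
  (lebesgue (eucl_ball c r) = ((2 * r) ^+ d)%:E * lebesgue (unit_diam_ball R d))%E.
Proof.
move=> r0; have h0 : 0 < (2^-1 : R) by rewrite invr_gt0.
apply/eqP; rewrite eq_le; apply/andP; split.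
  by have := lebesgue_eucl_ball_le c 0 r0 h0; rewrite invrK mulrC.
have p0 : 0 < (2 * r) ^+ d by rewrite exprn_gt0// mulr_gt0.
rewrite muleC -lee_pdivlMr// muleC.
apply: le_trans (lebesgue_eucl_ball_le 0 c h0 r0) _.
by rewrite -exprVn invfM mulrC.
Qed.

End EuclideanNorm.

(** * Constraints on the radii of balls that avoid integral distances *)

Section Radii.
Variables (R : realType) (d : nat).
Implicit Types (P : set 'rV[R]_d) (c : 'rV[R]_d) (r : R).

Lemma enorm_delta (i : 'I_d) : enorm (delta_mx ord0 i : 'rV[R]_d) = 1.
Proof.
rewrite /enorm (bigD1 i)//= big1 ?addr0 => [|j /negbTE ji].
  by rewrite mxE !eqxx expr1n sqrtr1.
by rewrite mxE ji andbF expr0n.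
Qed.

(** If [r] exceeded 1/2, the ball would contain the two points at distance 1/2 from [c] on either
    side along a coordinate axis. *)
Lemma avoids_radius P c r : (0 < d)%N -> avoids_integral_distances P ->
  eucl_ball c r `<=` P -> r <= 2^-1.
Proof.
move=> d0 Pav cP; rewrite leNgt; apply/negP => r2.
pose e : 'rV[R]_d := delta_mx ord0 (Ordinal d0).
have inB t : `|t| = 2^-1 -> eucl_ball c r (c - t *: e).
  by move=> t2; rewrite eucl_ballE opprB addrC subrK enormZ enorm_delta mulr1 t2.
have h0 : `|2^-1 : R| = 2^-1 by rewrite ger0_norm.
have h1 : `|- 2^-1 : R| = 2^-1 by rewrite normrN.
apply: (Pav _ _ (cP _ (inB _ h0)) (cP _ (inB _ h1)) 1%N) => //.
rewrite eucl_distE.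
have -> : c - 2^-1 *: e - (c - (- 2^-1) *: e) = (- 1) *: e.
  by apply/rowP => j; rewrite !mxE; field.
by rewrite enormZ enorm_delta mulr1 normrN1.
Qed.

(** Otherwise the point dividing the segment between the centres in the ratio [r : r'] would lie in
    both balls. *)
Lemma disjoint_balls_dist c c' r r' : 0 < r -> 0 < r' ->
  eucl_ball c r `&` eucl_ball c' r' = set0 -> r + r' <= enorm (c' - c).
Proof.
move=> r0 r'0 dis; rewrite leNgt; apply/negP => lt.
have S0 : 0 < r + r' by rewrite addr_gt0.
have inter s : 0 < s -> s / (r + r') * enorm (c' - c) < s.
  by move=> s0; rewrite mulrAC ltr_pdivrMr// ltr_pM2l.
have : (eucl_ball c r `&` eucl_ball c' r') (c + (r / (r + r')) *: (c' - c)).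
  split; rewrite eucl_ballE.
    rewrite opprD addNKr -scaleNr enormZ normrN ger0_norm ?inter//.
    by rewrite divr_ge0 ?ltW.
  have -> : c' - (c + (r / (r + r')) *: (c' - c)) = (r' / (r + r')) *: (c' - c).
    by apply/rowP => j; rewrite !mxE; field; rewrite gt_eqF.
  by rewrite enormZ ger0_norm ?inter// divr_ge0 ?ltW.
by rewrite dis.
Qed.

(** If [S = r + r'] exceeded 1/2, the open interval from [D - S] to [D + S] would be longer than 1
    and contain [k.+1], where [k] is the floor of [D - S]. Disjointness makes [D - S]
    nonnegative. *)
Lemma avoids_radii P c c' r r' : avoids_integral_distances P ->
  0 < r -> 0 < r' -> eucl_ball c r `<=` P -> eucl_ball c' r' `<=` P ->
  eucl_ball c r `&` eucl_ball c' r' = set0 -> r + r' <= 2^-1.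
Proof.
move=> Pav r0 r'0 cP c'P dis; rewrite leNgt; apply/negP => rr'.
have := disjoint_balls_dist r0 r'0 dis.
set D := enorm (c' - c) => SD.
have S0 : 0 < r + r' by rewrite addr_gt0.
have D0 : 0 < D by apply: lt_le_trans SD.
have /truncn_itv : 0 <= D - (r + r') by rewrite subr_ge0.
set k := Num.truncn _ => /andP[k1 k2].
have k3 : k.+1%:R = k%:R + 1 :> R by rewrite -natr1.
(* Moving the centres by [t * r] and [t * r'] in opposite directions along their axis changes their
   distance to [D + t * (r + r')]; this [t] makes it [k.+1]. *)
pose t := (k.+1%:R - D) / (r + r').
have t1 : `|t| < 1.
  by rewrite ltr_norml /t ltr_pdivlMr// ltr_pdivrMr//; apply/andP; split; lra.
pose u := D^-1 *: (c' - c).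
have u1 : enorm u = 1.
  by rewrite enormZ gtr0_norm ?invr_gt0// mulVf// gt_eqF.
have inB (a : 'rV[R]_d) s : 0 < s -> eucl_ball a s (a - (t * s) *: u).
  move=> s0; rewrite eucl_ballE opprB addrC subrK enormZ u1 mulr1 normrM (gtr0_norm s0).
  by rewrite gtr_pMl.
have inB' : eucl_ball c' r' (c' + (t * r') *: u).
  rewrite eucl_ballE opprD addNKr -scaleNr enormZ u1 mulr1 normrN normrM (gtr0_norm r'0).
  by rewrite gtr_pMl.
apply: (Pav _ _ (cP _ (inB _ _ r0)) (c'P _ inB') k.+1) => //.
rewrite eucl_distE.
have -> : c - (t * r) *: u - (c' + (t * r') *: u) = - (D + t * (r + r')) *: u.
  by apply/rowP => j; rewrite !mxE; field; rewrite gt_eqF.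
by rewrite enormZ u1 mulr1 normrN /t divfK ?gt_eqF// addrC subrK ger0_norm.
Qed.

End Radii.

(** * Convexity bound for the diameters, and the upper bound *)

(** [(1 + s) / 2] is the mean of 1 and 1/2 with weights [s] and [1 - s], so this is convexity of the
    [m]-th power between these points. *)
Lemma half_sum_expr_le (R : realFieldType) (s : R) (m : nat) :
  0 <= s <= 1 -> ((1 + s) / 2) ^+ m <= s + (1 - s) / 2 ^+ m.
Proof.
move=> /andP[s0 s1]; elim: m => [|m IH]; first by rewrite !expr0; lra.
have q0 : 0 < (2 ^+ m : R)^-1 by rewrite invr_gt0 exprn_gt0.
have q1 : (2 ^+ m : R)^-1 <= 1 by rewrite invf_le1 ?exprn_gt0// exprn_ege1// ler1n.
rewrite exprS; apply: le_trans (ler_wpM2l _ IH) _; first by lra.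
rewrite [2 ^+ m.+1]exprS invfM; move: q0 q1; set q := (2 ^+ m)^-1 => q0 q1.
have -> : s + (1 - s) * (2^-1 * q) =
  (1 + s) / 2 * (s + (1 - s) * q) + s * (1 - s) * (1 - q) / 2 by field.
by rewrite lerDl divr_ge0// !mulr_ge0// subr_ge0.
Qed.

(** The [s i] are meant as diameters. If one of them exceeds 1/2, the others are small, and the sum
    is at most a convex combination of 1 and [n%:R / 2 ^+ m]; otherwise each term is at most
    [1 / 2 ^+ m]. *)
Lemma sum_expr_le (R : realFieldType) (n m : nat) (s : nat -> R) :
  (forall i, (i < n)%N -> 0 <= s i <= 1) ->
  (forall i j, (i < n)%N -> (j < n)%N -> i != j -> s i + s j <= 1) -> (0 < m)%N ->
  \sum_(i < n) s i ^+ m <= Num.max 1 (n%:R / 2 ^+ m).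
Proof.
move=> s01 sij m0; have p0 : 0 < (2 ^+ m : R) by rewrite exprn_gt0.
have [[i]|small] := pselect (exists i : 'I_n, 2^-1 < s i); last first.
  rewrite le_max; apply/orP; right.
  apply: (@le_trans _ _ (\sum_(i < n) (2 ^+ m : R)^-1)); last first.
    by rewrite sumr_const card_ord mulr_natl.
  apply: ler_sum => i _; rewrite -exprVn lerXn2r// ?nnegrE ?invr_ge0//.
    by have /andP[] := s01 i (ltn_ord i).
  by rewrite leNgt; apply/negP => h; apply: small; exists i.
move=> i2; have /andP[_ si1] := s01 i (ltn_ord i).
(* With this weight [s i = (1 + t) / 2], and every other [s j] is at most [(1 - t) / 2]. *)
pose t := 2 * s i - 1.
have t01 : 0 <= t <= 1 by rewrite /t; lra.
have n1 : n%:R = 1 + n.-1%:R :> R.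
  by rewrite nat1r prednK// (leq_trans _ (ltn_ord i)).
have bnd : \sum_(j < n) s j ^+ m <= t * 1 + (1 - t) * (n%:R / 2 ^+ m).
  have -> : t * 1 + (1 - t) * (n%:R / 2 ^+ m) =
      (t + (1 - t) / 2 ^+ m) + n.-1%:R * ((1 - t) / 2 ^+ m).
    by rewrite n1; move: (_^-1) => q; ring.
  rewrite (bigD1 i)//=; apply: lerD.
    have := half_sum_expr_le m t01.
    by have -> : (1 + t) / 2 = s i by rewrite /t; field.
  apply: (@le_trans _ _ (\sum_(j < n | j != i) ((1 - t) / 2 ^+ m))).
    apply: ler_sum => j ji.
    have /andP[sj0 _] := s01 j (ltn_ord j).
    have sj : s j <= (1 - t) / 2.
      by have := sij _ _ (ltn_ord i) (ltn_ord j); rewrite eq_sym ji /t => /(_ isT); lra.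
    apply: (@le_trans _ _ (((1 - t) / 2) ^+ m)).
      by rewrite lerXn2r// ?nnegrE ?(le_trans sj0).
    rewrite exprMn exprVn ler_pM2r ?invr_gt0//.
    (* [(1 - t) ^+ m <= 1 - t], because [1 - t] lies in [[0, 1]] and [m] is positive. *)
    rewrite -[leRHS]expr1 ler_wiXn2l//; lra.
  by rewrite sumr_const cardC1 card_ord mulr_natl.
apply: le_trans bnd _.
have h1 : 1 <= Num.max 1 (n%:R / 2 ^+ m) :> R by rewrite le_max lexx.
have h2 : n%:R / 2 ^+ m <= Num.max 1 (n%:R / 2 ^+ m) :> R by rewrite le_max lexx orbT.
move: h1 h2; set M := Num.max _ _; set q := _ / _ => h1 h2.
have {1}-> : M = t * M + (1 - t) * M by ring.
by move: t01 => /andP[? ?]; apply: lerD; apply: ler_wpM2l => //; lra.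
Qed.

Lemma lebesgue_configuration_le (R : realType) (d n : nat) (P : set 'rV[R]_d) :
  (0 < d)%N -> ball_configuration n P ->
  (lebesgue P <= (Num.max 1 (n%:R / 2 ^+ d))%:E * lebesgue (unit_diam_ball R d))%E.
Proof.
move=> d0 [_ Pav Pn Pball].
have /card_set_bijP[F [FP Finj Fsurj]] := card_esym Pn.
(* A centre and a radius are chosen for every [k]; [(0, 0)] is a dummy for [k >= n]. *)
have /choice[cr Fcr] : forall k, exists cr : 'rV[R]_d * R,
    (k < n)%N -> 0 < cr.2 /\ F k = eucl_ball cr.1 cr.2.
  move=> k; case: (ltnP k n) => kn; last by exists (0, 0).
  by have [c [r cr]] := Pball _ (FP _ kn); exists (c, r).
pose r k := (cr k).2.
have r0 k : (k < n)%N -> 0 < r k by move=> /Fcr[].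
have FsubP k : (k < n)%N -> eucl_ball (cr k).1 (r k) `<=` P.
  move=> kn; have [_ <-] := Fcr k kn; have [x _ <-] := FP _ kn.
  exact: connected_component_sub.
have PF : P `<=` \bigcup_(k in `I_n) F k.
  move=> x Px; have [|k kn Fk] := Fsurj (connected_component P x); first by exists x.
  by exists k => //; rewrite Fk; exact: connected_component_refl.
have dis i j : (i < n)%N -> (j < n)%N -> i != j ->
    eucl_ball (cr i).1 (r i) `&` eucl_ball (cr j).1 (r j) = set0.
  move=> iN jN /eqP ij; rewrite -subset0 => x.
  rewrite -(Fcr i iN).2 -(Fcr j jN).2 => -[Fi Fj]; apply: ij.
  apply: Finj; rewrite ?inE//.
  move: Fi Fj; have [y _ <-] := FP _ iN; have [z _ <-] := FP _ jN => yx zx.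
  by rewrite (same_connected_component yx) (same_connected_component zx).
(* Subadditivity reduces the claim to a bound on the sum of the [(2 * r k) ^+ d]. *)
apply: le_trans (lebesgue_cover_sum d0 PF) _.
rewrite (eq_bigr (fun k : 'I_n => ((2 * r k) ^+ d)%:E * lebesgue (unit_diam_ball R d))%E); last first.
  by move=> k _; rewrite (Fcr k (ltn_ord k)).2 lebesgue_eucl_ball ?(Fcr k (ltn_ord k)).1.
rewrite -ge0_sume_distrl; last first.
  by move=> k _; rewrite lee_fin exprn_ge0// mulr_ge0// ltW ?r0.
rewrite sumEFin; apply: lee_wpmul2r; first exact: lebesgue_ge0.
rewrite lee_fin; apply: (@sum_expr_le _ n d (fun k => 2 * r k)) => //.
  move=> k kn; have := avoids_radius d0 Pav (FsubP k kn).
  have := r0 k kn; lra.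
move=> i j iN jN ij.
have := avoids_radii Pav (r0 i iN) (r0 j jN) (FsubP i iN) (FsubP j jN) (dis i j iN jN ij).
lra.
Qed.

(** * Components of a finite disjoint union of connected open sets *)

(** [F i] is open, and it is closed in the union because the other sets are open; hence a component
    meeting [F i] stays inside it. *)
Lemma connected_component_bigcup (T : topologicalType) (n : nat) (F : nat -> set T) :
  (forall i, (i < n)%N -> open (F i)) -> (forall i, (i < n)%N -> connected (F i)) ->
  (forall i j, (i < n)%N -> (j < n)%N -> i != j -> F i `&` F j = set0) ->
  forall i x, (i < n)%N -> F i x ->
  connected_component (\bigcup_(k in `I_n) F k) x = F i.
Proof.
move=> Fo Fc dis i x iN Fx; set P := \bigcup_(k in _) _.
have FP : F i `<=` P by move=> y Fy; exists i.
apply/seteqP; split; last by apply: connected_component_max => //; exact: Fc.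
set C := connected_component P x.
have Cx : C x by apply: connected_component_refl; exact: FP.
suff <- : C `&` F i = C by exact: subIsetr.
apply: (@component_connected _ P x) => //.
- by exists x.
- by exists (F i) => //; exact: Fo.
exists (~` \bigcup_(k in [set k | (k < n)%N && (k != i)]) F k).
  by apply: open_closedC; apply: bigcup_open => k /andP[kn _]; exact: Fo.
apply/seteqP; split => y [Cy].
  move=> Fiy; split => // -[k /andP[kn ki] Fky].
  by have : (F k `&` F i) y by []; rewrite dis.
move=> nF; split => //; have [k /= kn Fky] := connected_component_sub Cy.
by have [<-//|ki] := eqVneq k i; exfalso; apply: nF; exists k => //=; rewrite kn.
Qed.

Lemma components_bigcup (T : topologicalType) (n : nat) (F : nat -> set T) :
  (forall i, (i < n)%N -> open (F i)) -> (forall i, (i < n)%N -> connected (F i)) ->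
  (forall i, (i < n)%N -> F i !=set0) ->
  (forall i j, (i < n)%N -> (j < n)%N -> i != j -> F i `&` F j = set0) ->
  connected_component (\bigcup_(k in `I_n) F k) @` (\bigcup_(k in `I_n) F k) = F @` `I_n.
Proof.
move=> Fo Fc Fn dis; have cc := connected_component_bigcup Fo Fc dis.
apply/seteqP; split => [_ [x [i /= iN Fx] <-]|_ [i /= iN <-]].
  by exists i => //; rewrite (cc i).
by have [x Fx] := Fn i iN; exists x; [exists i|rewrite (cc i)].
Qed.

(** * Configurations of balls centred on a parabola *)

Section Parabola.
Variable R : realType.

(* (b - a) sqrt((b + a)^2 + 1) is b^2 - a^2 plus (b - a) / ((b + a) + sqrt((b + a)^2 + 1)),
   which tends to 1/2 as b / a grows. *)
Lemma parabola_dist (a b e : R) : 1 <= a -> a + 1 <= b -> 0 <= e <= 2^-1 -> 2 * a <= e * b ->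
  b ^+ 2 - a ^+ 2 + 2^-1 - e <= Num.sqrt ((b ^+ 2 - a ^+ 2) ^+ 2 + (b - a) ^+ 2)
    <= b ^+ 2 - a ^+ 2 + 2^-1.
Proof.
move=> a1 ab /andP[e0 e1] eb; have N0 : 0 <= b ^+ 2 - a ^+ 2 by nra.
apply/andP; split.
  rewrite -[leLHS]ger0_norm; last by lra.
  rewrite -sqrtr_sqr ler_sqrt ?addr_ge0 ?sqr_ge0//.
  (* After squaring, the lower bound says that this product is at least [(2^-1 - e) ^+ 2], which is
     at most 1/4. *)
  have h : 1 <= (b - a) * (2 * e * (a + b) - 2 * a).
    rewrite -[leLHS]mulr1; apply: ler_pM => //; nra.
  nra.
rewrite -[leRHS]ger0_norm; last by lra.
rewrite -sqrtr_sqr ler_sqrt ?sqr_ge0//; nra.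
Qed.

(** Coordinates are tested by value, so the row is defined for every [d]. *)
Definition parabola_point (d K k : nat) : 'rV[R]_d :=
  \row_j (if val j == 0%N then (K ^ k)%:R ^+ 2
          else if val j == 1%N then (K ^ k)%:R else 0).

Variables (n d K : nat) (rho : nat -> R).
Hypotheses (d2 : (2 <= d)%N) (K4 : (4 <= K)%N).
Hypothesis rho2 : forall i, 0 < rho i <= 2^-1.
(** [2 / K%:R] serves as the error [e] of [parabola_dist] for the distances between centres. *)
Hypothesis rhoK : forall i j, i != j -> rho i + rho j <= 2^-1 - 2 / K%:R.

Let m k : R := (K ^ k)%:R.
Let F k := eucl_ball (parabola_point d K k) (rho k).
Let P := \bigcup_(k in `I_n) F k.

Let m_ge1 k : 1 <= m k.
Proof. by rewrite /m ler1n expn_gt0 (leq_trans _ K4). Qed.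

Let m_lt i j : (i < j)%N -> K%:R * m i <= m j.
Proof.
by move=> ij; rewrite /m -natrM -expnS ler_nat leq_pexp2l// (leq_trans _ K4).
Qed.

Let K4R : 4 <= K%:R :> R. Proof. by rewrite ler_nat. Qed.

Let eucl_parabola i j : enorm (parabola_point d K j - parabola_point d K i) =
  Num.sqrt ((m j ^+ 2 - m i ^+ 2) ^+ 2 + (m j - m i) ^+ 2).
Proof.
rewrite /enorm; congr Num.sqrt.
have d0 : (0 < d)%N by apply: leq_trans d2.
rewrite (bigD1 (Ordinal d0))//= (bigD1 (Ordinal d2))//= big1 ?addr0.
  by rewrite !mxE.
move=> [[|[|k]] kd] /andP[] //= _ _.
by rewrite !mxE/= subr0 expr0n.
Qed.

(** With [e = 2 / K%:R], the centres are at distance between [N + 1/2 - e] and [N + 1/2]. The radii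
    sum to at most [1/2 - e] and the balls are open, so the triangle inequality keeps the distance
    strictly between [N] and [N + 1]. *)
Let dist_lt i j : (i < j)%N -> forall x y, F i x -> F j y ->
  exists N : nat, N%:R < enorm (x - y) < N.+1%:R.
Proof.
move=> ij x y; rewrite /F !eucl_ballE => Fx Fy.
have K0 : 0 < K%:R :> R by have := K4R; lra.
have mi1 := m_ge1 i; have mij := m_lt ij.
have e0 : 0 <= 2 / K%:R :> R by rewrite divr_ge0.
have e1 : 2 / K%:R <= 2^-1 :> R by have := K4R; rewrite ler_pdivrMr//; lra.
have e01 : 0 <= (2 / K%:R : R) <= 2^-1 by rewrite e0.
have eb : 2 * m i <= 2 / K%:R * m j by rewrite -mulrA ler_pM2l// mulrC ler_pdivlMr// mulrC.
have ab : m i + 1 <= m j by have := K4R; nra.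
have := parabola_dist mi1 ab e01 eb; rewrite -eucl_parabola => /andP[D1 D2].
(* The natural subtraction does not truncate, since [i < j]. *)
exists ((K ^ j) ^ 2 - (K ^ i) ^ 2)%N; set N := (_ - _)%N.
have NE : N%:R = m j ^+ 2 - m i ^+ 2 :> R.
  rewrite /N natrB; first by rewrite natrX [X in _ - X]natrX.
  by rewrite leq_exp2r// leq_pexp2l ?(leq_trans _ K4)// ltnW.
rewrite -natr1 NE.
have ne : i != j by rewrite ltn_eqF.
have rr := rhoK ne.
set p := parabola_point d K i in Fx D1 D2 *; set q := parabola_point d K j in Fy D1 D2 *.
have T1 : enorm (q - p) <= enorm (q - y) + (enorm (x - y) + enorm (p - x)).
  rewrite (enorm_distC x y) (enorm_distC p x).
  have -> : q - p = (q - y) + ((y - x) + (x - p)) by rewrite !addrA !subrK.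
  by apply: le_trans (enormD _ _) _; rewrite lerD2l enormD.
have T2 : enorm (x - y) <= enorm (p - x) + (enorm (q - p) + enorm (q - y)).
  rewrite (enorm_distC p x) (enorm_distC q p).
  have -> : x - y = (x - p) + ((p - q) + (q - y)) by rewrite !addrA !subrK.
  by apply: le_trans (enormD _ _) _; rewrite lerD2l enormD.
by apply/andP; split; lra.
Qed.

Let avoids : avoids_integral_distances P.
Proof.
have between i j (ij : (i < j)%N) x y k : F i x -> F j y -> enorm (x - y) <> k%:R.
  move=> Fx Fy xy; have [N] := dist_lt ij Fx Fy; rewrite xy !ltr_nat => /andP[Nk].
  by rewrite ltnS leqNgt Nk.
move=> x y [i _ Fx] [j _ Fy] k k0; rewrite eucl_distE.
have [ij|ji|ij] := ltngtP i j; first exact: between Fx Fy.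
  by rewrite enorm_distC; exact: between Fy Fx.
(* Two points of one open ball of radius at most 1/2 are at distance below 1. *)
subst j; move: Fx Fy; rewrite /F !eucl_ballE; set p := parabola_point d K i => Fx Fy.
have T : enorm (x - y) <= enorm (p - x) + enorm (p - y).
  rewrite (enorm_distC p x); have -> : x - y = (x - p) + (p - y) by rewrite addrA subrK.
  exact: enormD.
have k1 : 1 <= k%:R :> R by rewrite ler1n.
by have /andP[_ ?] := rho2 i; move=> xy; rewrite xy in T; lra.
Qed.

Let d0 : (0 < d)%N. Proof. exact: leq_trans d2. Qed.
Let i0 := Ordinal d0.
(** Slab boundaries in the first coordinate: the centres sit at [m k ^+ 2], successive values differ
    by at least 1, and radii are at most 1/2. *)
Let s k := m k ^+ 2 - 2^-1.

Let m_mono : {homo m : i j / (i <= j)%N >-> i <= j}.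
Proof. by move=> i j ij; rewrite /m ler_nat leq_pexp2l// (leq_trans _ K4). Qed.

Let s_mono : {homo s : i j / (i <= j)%N >-> i <= j}.
Proof.
move=> i j ij; rewrite lerD2r lerXn2r ?m_mono// nnegrE; exact: ler0n.
Qed.

Let slab k x : F k x -> s k < x ord0 i0 <= s k.+1.
Proof.
rewrite /F eucl_ballE => Fx.
have := le_lt_trans (coord_le_enorm _ i0) Fx; rewrite !mxE/= -/(m k) ltr_norml.
have /andP[_ h2] := rho2 k.
move=> /andP[h3 h4].
have := m_lt (ltnSn k); have := m_ge1 k; rewrite /s => h5 h6.
have h7 : m k + 1 <= m k.+1 by have := K4R; nra.
have h8 : m k ^+ 2 + 1 <= m k.+1 ^+ 2 by nra.
by apply/andP; split; lra.
Qed.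

Let dis i j : i != j -> F i `&` F j = set0.
Proof.
wlog ij : i j / (i < j)%N => [hw|_].
  rewrite neq_ltn => /orP[] ij; last rewrite setIC; apply: hw => //.
    by rewrite ltn_eqF.
  by rewrite ltn_eqF.
rewrite -subset0 => x [/slab /andP[_ h1] /slab /andP[h2 _]].
by have := le_lt_trans (le_trans h1 (s_mono ij)) h2; rewrite ltxx.
Qed.

Lemma parabola_ball_configuration : ball_configuration n P.
Proof.
have Fo i : (i < n)%N -> open (F i) by move=> _; exact: open_eucl_ball.
have rho0 i : 0 < rho i by have /andP[] := rho2 i.
have Fc i : (i < n)%N -> connected (F i) by move=> _; exact: connected_eucl_ball.
have Fn i : (i < n)%N -> F i !=set0.
  by move=> _; exists (parabola_point d K i); exact: eucl_ball_center.
have FE : components P = F @` `I_n.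
  by apply: components_bigcup => // i j _ _; exact: dis.
split.
- by apply: bigcup_open => i; exact: Fo.
- exact: avoids.
(* Nonempty disjoint sets are distinct, so there are exactly [n] components. *)
- rewrite FE; apply: inj_card_eq => i j /set_mem iN _ Fij.
  apply/eqP/negPn/negP => /dis; rewrite Fij setIid => Fj0.
  by have [x] := Fn i iN; rewrite Fij Fj0.
- by rewrite FE => _ [i _ <-]; exists (parabola_point d K i), (rho i).
Qed.

(** The balls lie in successive slabs, so the sum of their measures is at most the measure of their
    union. *)
Lemma parabola_configuration_f_circ :
  (\sum_(k < n) ((2 * rho k) ^+ d)%:E * lebesgue (unit_diam_ball R d) <= f_circ R d n)%E.
Proof.
apply: (@le_trans _ _ (lebesgue P)); last first.
  by apply: ereal_sup_ubound; exists P => //; exact: parabola_ball_configuration.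
apply: le_trans (@lebesgue_sum_separated _ _ i0 F s n _ s_mono).
  rewrite le_eqVlt; apply/orP; left; apply/eqP; apply: eq_bigr => k _.
  by rewrite (lebesgue_eucl_ball (parabola_point d K k))//; have /andP[] := rho2 k.
by move=> k x _; exact: slab.
Qed.

End Parabola.

(** * Limit in the radii, and the lower bound *)

(** Every factor [r < 1] is dominated by [s ^+ d] for some [s < 1]. This lets the radii tend to
    values that the construction does not attain. *)
Lemma le_mul_exprPr (R : realType) (d : nat) (x y : \bar R) : (0 < d)%N -> (0 <= x)%E ->
  (forall s : R, 0 < s < 1 -> ((s ^+ d)%:E * x <= y)%E) -> (x <= y)%E.
Proof.
move=> d0 x0 h; apply/(lee_mul01Pr _ x0) => r /andP[r0 r1].
have d0R : 1 <= d%:R :> R by rewrite ler1n.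
(* Bernoulli's inequality then gives [s ^+ d >= 1 - (1 - r) = r]. *)
pose s := 1 - (1 - r) / d%:R.
have d0R' : 0 < d%:R :> R by lra.
have r1' : 0 < 1 - r by lra.
have q0 : 0 < (1 - r) / d%:R by rewrite divr_gt0.
have q1 : (1 - r) / d%:R <= 1 - r by rewrite ler_pdivrMr// ler_peMr// ltW.
have bernoulli k : 1 - k%:R * ((1 - r) / d%:R) <= s ^+ k.
  elim: k => [|k IH]; first by rewrite mul0r subr0 expr0.
  rewrite exprS; apply: (@le_trans _ _ (s * (1 - k%:R * ((1 - r) / d%:R)))).
    have k0 : 0 <= k%:R :> R by [].
    rewrite -natr1 /s; move: q0; set t := _ / _ => t0.
    have : 0 <= k%:R * (t * t) by rewrite !mulr_ge0// ltW.
    nra.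
  by rewrite ler_wpM2l// /s; lra.
have rs : r <= s ^+ d.
  by have := bernoulli d; rewrite mulrCA mulfV ?mulr1; [lra|rewrite gt_eqF].
apply: le_trans (h s _); last by rewrite /s; lra.
by apply: lee_wpmul2r; rewrite ?lee_fin.
Qed.

Lemma f_circ_ge (R : realType) (n d : nat) : (1 <= n)%N -> (2 <= d)%N ->
  ((Num.max 1 (n%:R / 2 ^+ d))%:E * lebesgue (unit_diam_ball R d) <= f_circ R d n)%E.
Proof.
move=> n1 d2; have d0 : (0 < d)%N by apply: leq_trans d2.
set V := lebesgue _; have V0 : (0 <= V)%E by exact: lebesgue_ge0.
have param (s : R) : 0 < s < 1 ->
    exists2 K : nat, (4 <= K)%N & 2 / K%:R <= (1 - s) / 6.
  (* Any [K] above [12 / (1 - s)] exceeds 12 and makes the error [2 / K%:R] at most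
     [(1 - s) / 6]. *)
  move=> /andP[s0 s1]; pose K := (Num.truncn (12 / (1 - s))).+1.
  have K12 : 12 / (1 - s) < K%:R by exact: truncnS_gt.
  have K12' : 12 < K%:R * (1 - s) by rewrite -ltr_pdivrMr ?subr_gt0.
  have K0 : 0 < K%:R :> R by [].
  exists K; first by rewrite -(ler_nat R); nra.
  rewrite ler_pdivrMr//; lra.
have one : (V <= f_circ R d n)%E.
  apply: (le_mul_exprPr d0 V0) => s s01; have [K K4 Ks] := param s s01.
  move: s01 => /andP[s0 s1].
  (* One large ball and tiny others: [s / 2 + (1 - s) / 6] plus the error [(1 - s) / 6] stays below
     1/2. *)
  pose rho k : R := if k == 0%N then s / 2 else (1 - s) / 6.
  apply: le_trans (@parabola_configuration_f_circ R n d K rho d2 K4 _ _).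
  (* Only the ball of index 0 is counted; the others contribute nonnegative measure. *)
  - rewrite -(prednK n1) big_ord_recl /= {1}/rho/= mulrC divfK//.
    rewrite leeDl// sume_ge0// => k _; rewrite mule_ge0// lee_fin exprn_ge0//.
    by rewrite mulr_ge0// /rho /=; lra.
  - by move=> i; rewrite /rho; case: ifP => _; lra.
  - by move=> i j; rewrite /rho; case: i j => [|i] [|j] //= _; lra.
have many : ((n%:R / 2 ^+ d)%:E * V <= f_circ R d n)%E.
  apply: (le_mul_exprPr d0) => [|s s01].
    by rewrite mule_ge0// lee_fin divr_ge0// exprn_ge0.
  have [K K4 Ks] := param s s01; move: s01 => /andP[s0 s1].
  (* Equal radii [s / 4]: two of them plus the error [(1 - s) / 6] stay below 1/2. *)
  apply: le_trans (@parabola_configuration_f_circ R n d K (fun=> s / 4) d2 K4 _ _).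
  - rewrite -ge0_sume_distrl; last first.
      by move=> k _; rewrite lee_fin exprn_ge0// mulr_ge0// divr_ge0// ltW.
    rewrite sumEFin sumr_const card_ord muleA -EFinM.
    have -> : 2 * (s / 4) = s / 2 by field.
    suff -> : (s / 2) ^+ d *+ n = s ^+ d * (n%:R / 2 ^+ d) by [].
    by rewrite exprMn exprVn mulrCA mulr_natl.
  - by move=> i; lra.
  - by move=> i j _; lra.
by rewrite /Num.max; case: ifP => _; rewrite ?mul1e.
Qed.

Theorem theorem4 (R : realType) (n d : nat) (hn : (1 <= n)%N) (hd : (2 <= d)%N) :
  f_circ R d n =
    ((Num.max 1 (n%:R / 2 ^+ d))%:E * lebesgue (unit_diam_ball R d))%E.
Proof.
apply/eqP; rewrite eq_le f_circ_ge// andbT.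
apply: ge_ereal_sup => _ [P /lebesgue_configuration_le cP <-].
by apply: cP; exact: leq_trans hd.
Qed.
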